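(* Every regular semigroup weakly generated by a finite set of idempotents strongly divides $F_1$; that is, it is a homomorphic image of some regular subsemigroup of $F_1$.
   Context: A semigroup is regular if for each element $s$ there is $t$ with $sts=s$. A regular semigroup $S$ is weakly generated by a subset $X\subseteq S$ if no proper regular subsemigroup of $S$ contains $X$. **The set $G$.** Let $A=\{1,x,x'\}$ (three distinct symbols) with involution $'$ exchanging $x$ and $x'$ and fixing $1$. A 5-tuple is written $g=(g^{l},g^{la},g^{c},g^{ra},g^{r})$. Put $g_{xx'}=(1,1,x,x',1)$, $G_{1,e}=\{g_{xx'}\}$ and, for $i\ge 2$, $G_{i,e}=\{(g,(g^{la})',g^l,(g^{ra})',g),\ (g,(g^{ra})',g^l,(g^{la})',g) : g\in G_{i-1,e}\}$. Put $G_{1,d}=G_{2,d}=\emptyset$ and $G_i=G_{i,e}\cup G_{i,d}$, where recursively for $i\ge 3$, $G_{i,d}$ is the set of all $g\in G_{i-1}\times A\times G_{i-2}\times A\times G_{i-1}$ such that: (1) $g^l\neq g^r$; (2) $(g^c,g^{la})$ equals $((g^l)^l,((g^l)^{la})')$ or $((g^l)^r,((g^l)^{ra})')$; (3) $(g^c,g^{ra})$ equals $((g^r)^l,((g^r)^{la})')$ or $((g^r)^r,((g^r)^{ra})')$. Let $G^5=\bigcup_{i\ge1}G_i$, $G'=G^5\cup\{1\}$, $G=G^5\cup A$. The height is $\upsilon(1)=0$ and $\upsilon(g)=i$ for $g\in G_i$. **The semigroups $F_1^1$ and $F_1$.** For $g\in G^5$ with $\upsilon(g)\ge2$ let $g^L=(g^{la})'g^lg^{la}$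 and $g^R=(g^{ra})'g^rg^{ra}$, words in the free semigroup $G^+$. Let $\rho$ be the smallest congruence on $G^+$ containing the pairs $(xx'x,x)$, $(x'xx',x')$, $(g_{xx'},xx')$; the pairs $(1g,g)$, $(g1,g)$ for $g\in G$; the pairs $(g^2,g)$ for $g\in G'$; and, for every $g\in G^5$ with $\upsilon(g)\ge 2$, the pairs $(g^cg^Lg,g)$, $(gg^Rg^c,g)$ and $(g^rg^{ra}g(g^{la})'g^l,\ g^rg^{ra}g^c(g^{la})'g^l)$. Write $[u]$ for the $\rho$-class of $u$. Then $F_1^1=G^+/\rho$ is a monoid with identity $[1]$, and $F_1=F_1^1\setminus\{[1]\}$ is a subsemigroup. *)

(* Defs.v *)
From HB Require Import structures.
From mathcomp Require Import all_boot.
From mathcomp Require Import boolp classical_sets cardinality.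

Set Implicit Arguments.
Unset Strict Implicit.
Unset Printing Implicit Defensive.

Local Open Scope classical_set_scope.
Local Open Scope group_scope.
Local Open Scope quotient_scope.

(* Subsemigroups are nonempty, as usual in semigroup theory. *)
Definition subsemigroup (M : semigroupType) (T : set M) : Prop :=
  T !=set0 /\ forall a b, T a -> T b -> T (a * b).

Definition regular (M : semigroupType) (T : set M) : Prop :=
  forall s, T s -> exists2 t, T t & s * t * s = s.

Definition weakly_generated (M : semigroupType) (X : set M) : Prop :=
  forall T : set M, subsemigroup T -> regular T -> X `<=` T -> T = setT.

(* The homomorphism from T onto M is a total function on N of which only the
   values on T matter. *)
Definition strongly_divides (M N : semigroupType) : Prop :=
  exists (T : set N) (phi : N -> M),
    [/\ subsemigroup T, regular T,
        (forall a b, T a -> T b -> phi (a * b) = phi a * phi b) &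
        phi @` T = setT].

Definition congruence (M : semigroupType) (R : M -> M -> Prop) : Prop :=
  [/\ forall a, R a a,
      forall a b, R a b -> R b a,
      forall a b c, R a b -> R b c -> R a c &
      forall a b c d, R a b -> R c d -> R (a * c) (b * d)].

Definition smallest_congruence (M : semigroupType) (P : M -> M -> Prop) :
    M -> M -> Prop :=
  fun u v => forall R : M -> M -> Prop,
    congruence R -> (forall a b, P a b -> R a b) -> R u v.

Lemma smallest_congruenceP (M : semigroupType) (P : M -> M -> Prop) :
  congruence (smallest_congruence P).
Proof.
split=> [a R [r _ _ _] _|a b ab R cR PR|a b c ab bc R cR PR|a b c d ab cd R cR PR].
- exact: r.
- by have [_ + _ _] := cR; apply; exact: ab.
- by have [_ _ + _] := cR; apply; [exact: ab|exact: bc].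
- by have [_ _ _ +] := cR; apply; [exact: ab|exact: cd].
Qed.

Lemma smallest_congruence_sub (M : semigroupType) (P : M -> M -> Prop) a b :
  P a b -> smallest_congruence P a b.
Proof. by move=> Pab R _; apply. Qed.

Inductive A := A1 | Ax | Ax'.

Definition invA (a : A) : A :=
  match a with A1 => A1 | Ax => Ax' | Ax' => Ax end.

(* Formal nested 5-tuples (g^l, g^la, g^c, g^ra, g^r) over A; the set G of the
   paper is carved out of this type below. *)
Inductive elt := Sym of A | Tup of elt & A & elt & A & elt.

HB.instance Definition _ := gen_eqMixin elt.
HB.instance Definition _ := gen_choiceMixin elt.

(* The values of the projections on Sym are never used. *)
Definition gl g := if g is Tup l _ _ _ _ then l else g.
Definition gla g := if g is Tup _ la _ _ _ then la else A1.
Definition gc g := if g is Tup _ _ c _ _ then c else g.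
Definition gra g := if g is Tup _ _ _ ra _ then ra else A1.
Definition gr g := if g is Tup _ _ _ _ r then r else g.

Definition gxx' : elt := Tup (Sym A1) A1 (Sym Ax) Ax' (Sym A1).

Fixpoint Ge (i : nat) : set elt :=
  match i with
  | 0 => set0
  | 1 => [set gxx']
  | (_.+1 as j).+1 => [set h | exists2 g, Ge j g &
      h = Tup g (invA (gla g)) (gl g) (invA (gra g)) g \/
      h = Tup g (invA (gra g)) (gl g) (invA (gla g)) g]
  end.

Fixpoint Gd (i : nat) : set elt :=
  match i with
  | ((_.+1 as k).+1 as j).+1 => [set g | if g is Tup l la c ra r then
      [/\ [/\ (Ge j `|` Gd j) l, (Ge k `|` Gd k) c & (Ge j `|` Gd j) r],
          l <> r,
          (c, la) = (gl l, invA (gla l)) \/ (c, la) = (gr l, invA (gra l)) &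
          (c, ra) = (gl r, invA (gla r)) \/ (c, ra) = (gr r, invA (gra r))]
      else False]
  | _ => set0
  end.

(* The elements of Glev i, for i >= 1, are those of height i. *)
Definition Glev (i : nat) : set elt := Ge i `|` Gd i.

Definition G5 : set elt := \bigcup_(i in [set i | (1 <= i)%N]) Glev i.
Definition G' : set elt := G5 `|` [set Sym A1].
Definition G : set elt := G5 `|` range Sym.

Definition Gword : set (seq elt) :=
  [set w | w <> [::] /\ forall g, g \in w -> G g].

Definition Gplus : Type := {w : seq elt | w \in Gword}.
HB.instance Definition _ := Choice.copy Gplus {w : seq elt | w \in Gword}.

Definition word (w : seq elt) (wG : w \in Gword) : Gplus := exist _ w wG.

Lemma Gword_cat u v : u \in Gword -> v \in Gword -> u ++ v \in Gword.
Proof.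
rewrite !inE => -[u0 uG] [_ vG]; split; first by case: u u0 {uG}.
by move=> g; rewrite mem_cat => /orP[/uG|/vG].
Qed.

Definition Gplus_mul (u v : Gplus) : Gplus :=
  word (Gword_cat (valP u) (valP v)).

Lemma Gplus_mulA : associative Gplus_mul.
Proof. by move=> u v w; apply: val_inj; rewrite /= catA. Qed.

HB.instance Definition _ := isSemigroup.Build Gplus Gplus_mulA.

Definition gL g : seq elt := [:: Sym (invA (gla g)); gl g; Sym (gla g)].
Definition gR g : seq elt := [:: Sym (invA (gra g)); gr g; Sym (gra g)].

Inductive relator : seq elt -> seq elt -> Prop :=
| rel_xx'x : relator [:: Sym Ax; Sym Ax'; Sym Ax] [:: Sym Ax]
| rel_x'xx' : relator [:: Sym Ax'; Sym Ax; Sym Ax'] [:: Sym Ax']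
| rel_gxx' : relator [:: gxx'] [:: Sym Ax; Sym Ax']
| rel_1g g : G g -> relator [:: Sym A1; g] [:: g]
| rel_g1 g : G g -> relator [:: g; Sym A1] [:: g]
| rel_gg g : G' g -> relator [:: g; g] [:: g]
| rel_L i g : (2 <= i)%N -> Glev i g -> relator (gc g :: gL g ++ [:: g]) [:: g]
| rel_R i g : (2 <= i)%N -> Glev i g -> relator (g :: gR g ++ [:: gc g]) [:: g]
| rel_LR i g : (2 <= i)%N -> Glev i g ->
    relator [:: gr g; Sym (gra g); g; Sym (invA (gla g)); gl g]
            [:: gr g; Sym (gra g); gc g; Sym (invA (gla g)); gl g].

Lemma G_Sym a : G (Sym a). Proof. by right; exists a. Qed.

Lemma G_Glev i g : Glev i g -> G g.
Proof.
case: i => [[]//|i gi]; left; exists i.+1 => //.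
Qed.

Lemma Glev_components i g : (2 <= i)%N -> Glev i g ->
  [/\ G (gl g), G (gc g) & G (gr g)].
Proof.
case: i => [//|[//|i]] _ [[h hi]|].
  have hG : G h by apply: (@G_Glev i.+1); left.
  have hlG : G (gl h).
    case: i hi => [->|i /= [k ki]]; first exact: G_Sym.
    by case=> -> /=; apply: (@G_Glev i.+1); left.
  by case=> ->; split.
case: i => [//|i]; case: g => //= l la c ra r [[li ci ri] _ _ _].
by split; [exact: (@G_Glev i.+2)|exact: (@G_Glev i.+1)|exact: (@G_Glev i.+2)].
Qed.

(* Hence restricting relators to G^+ discards nothing. *)
Lemma relator_Gword u v : relator u v -> u \in Gword /\ v \in Gword.
Proof.
have G'G g : G' g -> G g by case=> [|->]; [left|right; exists A1].
have gxxG : G gxx' by apply: (@G_Glev 1); left.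
pose ok (w : seq elt) := forall g : elt, g \in w -> G g.
have ok0 : ok [::] by [].
have okC g w : G g -> ok w -> ok (g :: w).
  by move=> gG wG h; rewrite in_cons => /predU1P[->|/wG].
have sG := G_Sym.
suff: relator u v -> (u <> [::] /\ ok u) /\ (v <> [::] /\ ok v).
  by rewrite !inE => uv /uv.
case=> {u v} [|||g gG|g gG|g /G'G gG|i g i2 gi|i g i2 gi|i g i2 gi];
  try have [lG cG rG] := Glev_components i2 gi; try have gG := G_Glev gi;
  split; split=> //; rewrite /gL /gR /=;
  auto 10.
Qed.

Definition rho : Gplus -> Gplus -> Prop :=
  smallest_congruence (fun u v : Gplus => relator (val u) (val v)).

Lemma rho_congruence : congruence rho.
Proof. exact: smallest_congruenceP. Qed.

Definition rhob (u v : Gplus) : bool := `[< rho u v >].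

Lemma rhob_equiv : equiv_class_of rhob.
Proof.
have [r s t _] := rho_congruence; split=> [u|u v|v u w].
- exact/asboolP.
- by apply/asboolP/asboolP; exact: s.
- by move=> /asboolP uv /asboolP vw; apply/asboolP; exact: t uv vw.
Qed.

Canonical rho_equiv := EquivRelPack rhob_equiv.

Definition F11 : Type := {eq_quot rho_equiv}.
HB.instance Definition _ := Choice.copy F11 {eq_quot rho_equiv}.

Definition cls (u : Gplus) : F11 := \pi_({eq_quot rho_equiv}) u.
Definition rep (a : F11) : Gplus := repr (a : {eq_quot rho_equiv}).

Lemma cls_eq u v : cls u = cls v <-> rho u v.
Proof.
split=> [/eqmodP /asboolP//|uv].
by apply/eqmodP; apply/asboolP.
Qed.

Lemma repK a : cls (rep a) = a. Proof. exact: reprK. Qed.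

Definition F11_mul (a b : F11) : F11 := cls (rep a * rep b).

Lemma F11_mulE u v : F11_mul (cls u) (cls v) = cls (u * v).
Proof.
have [_ _ _ m] := rho_congruence; apply/cls_eq.
by refine (m _ _ _ _ _ _); refine ((cls_eq _ _).1 (repK _)).
Qed.

Lemma Sym_Gword a : [:: Sym a] \in Gword.
Proof. by rewrite inE; split=> // g; rewrite mem_seq1 => /eqP->; exact: G_Sym. Qed.

Definition word1 : Gplus := word (Sym_Gword A1).

Lemma F11_mulA : associative F11_mul.
Proof.
move=> a b c; rewrite -[a]repK -[b]repK -[c]repK !F11_mulE.
by rewrite mulgA.
Qed.

Lemma rho_1u u : rho (word1 * u) u.
Proof.
case: u => -[|g w] gw; first by case: (set_mem gw).
rewrite -/(word gw).
have [g0 wG] : Gword (g :: w) by exact: set_mem gw.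
have gG : G g by apply: wG; rewrite in_cons eqxx.
have [r s t m] := rho_congruence.
have g1 : [:: g] \in Gword by rewrite inE; split=> // h; rewrite mem_seq1 => /eqP->.
have base : rho (word1 * word g1) (word g1).
  by apply: smallest_congruence_sub; exact: rel_1g.
case: w gw g0 wG => [|h w] gw _ wG.
  by rewrite (_ : word gw = word g1)//; exact: val_inj.
have w1 : h :: w \in Gword.
  by rewrite inE; split=> // k kw; apply: wG; rewrite in_cons kw orbT.
rewrite (_ : word gw = word g1 * word w1 :> Gplus); last first.
  exact: val_inj.
by rewrite mulgA; refine (m _ _ _ _ base (r _)).
Qed.

Lemma rho_u1 u : rho (u * word1) u.
Proof.
case: u => w; case/lastP: w => [|w g] gw; first by case: (set_mem gw).
rewrite -/(word gw).
have [g0 wG] : Gword (rcons w g) by exact: set_mem gw.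
have gG : G g by apply: wG; rewrite mem_rcons in_cons eqxx.
have [r s t m] := rho_congruence.
have g1 : [:: g] \in Gword by rewrite inE; split=> // h; rewrite mem_seq1 => /eqP->.
have base : rho (word g1 * word1) (word g1).
  by apply: smallest_congruence_sub; exact: rel_g1.
case: w gw g0 wG => [|h w] gw _ wG.
  by rewrite (_ : word gw = word g1)//; exact: val_inj.
have w1 : h :: w \in Gword.
  by rewrite inE; split=> // k kw; apply: wG; rewrite mem_rcons in_cons kw orbT.
rewrite (_ : word gw = word w1 * word g1 :> Gplus); last first.
  by apply: val_inj; rewrite /= -cats1.
by rewrite -mulgA; refine (m _ _ _ _ (r _) base).
Qed.

Lemma F11_mul1 : left_id (cls word1) F11_mul.
Proof. by move=> a; rewrite -[a]repK F11_mulE; exact: (cls_eq _ _).2 (rho_1u _). Qed.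

Lemma F11_mulr1 : right_id (cls word1) F11_mul.
Proof. by move=> a; rewrite -[a]repK F11_mulE; exact: (cls_eq _ _).2 (rho_u1 _). Qed.

HB.instance Definition _ := isMonoid.Build F11 F11_mulA F11_mul1 F11_mulr1.

(* The class [1] consists of words in the single letter 1, because each relator
   has a letter other than 1 on both sides or on neither. *)
Lemma rho_all1 u v : rho u v ->
  all (pred1 (Sym A1)) (val u) = all (pred1 (Sym A1)) (val v).
Proof.
pose R (a b : Gplus) :=
  all (pred1 (Sym A1)) (val a) = all (pred1 (Sym A1)) (val b).
apply: (_ : rho u v -> R u v) => uv; apply: uv => [|{}u {}v].
  split=> [//|a b|a b c ab bc|a b c d ab cd]; first exact: esym.
    exact: etrans ab bc.
  rewrite /R /= !all_cat.
  exact: (congr2 andb ab cd).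
have tupN l la c ra r : (Tup l la c ra r == Sym A1) = false by apply/eqP.
have glevN i g : Glev i g -> (g == Sym A1) = false.
  case: g => [a|*]; last by rewrite tupN.
  by case: i => [|[|i]] [] // => [[h _ []]|]; case: i.
have grN i g : (2 <= i)%N -> Glev i g -> (gr g == Sym A1) = false.
  case: i => [//|[//|i]] _ [[h hi]|].
    by case=> ->; apply: (glevN i.+1); left.
  case: i => [//|i]; case: g => //= l la c ra r [[_ _ ri] _ _ _].
  exact: (glevN i.+2).
have AxN : (Sym Ax == Sym A1) = false by apply/eqP.
have Ax'N : (Sym Ax' == Sym A1) = false by apply/eqP.
rewrite /R; case; rewrite /= ?AxN ?Ax'N ?tupN //.
- by move=> g _; rewrite eqxx.
- by move=> g _; rewrite eqxx.
- by move=> g _; case: (g == _).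
- by move=> i g _ /glevN ->; rewrite !andbF.
- by move=> i g _ /glevN ->.
- by move=> i g i2 gi; rewrite (grN i).
Qed.

Definition notunit : {pred F11} := [pred a | a != 1].

Lemma notunit_mul : mulg_closed notunit.
Proof.
have all1 u : all (pred1 (Sym A1)) (val u) -> cls u = 1.
  case: u => w ww /= w1; apply/cls_eq; rewrite -/(word ww).
  elim: w ww w1 => [|g w IH] ww; first by case: (set_mem ww).
  move=> /= /andP[/eqP ?]; subst g; case: w IH ww => [_ ww _|h w IH ww hw].
    rewrite (_ : word ww = word1); last exact: val_inj.
    by have [r _ _ _] := rho_congruence; exact: r.
  have w1 : h :: w \in Gword.
    have [_ wG] := set_mem ww; rewrite inE; split=> // k kw; apply: wG.
    by rewrite in_cons kw orbT.
  have [_ s t _] := rho_congruence.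
  apply: t (IH w1 hw); rewrite (_ : word ww = word1 * word w1).
    exact: rho_1u.
  exact: val_inj.
move=> a b; rewrite !inE => a1 _; apply: contra a1 => /eqP ab1.
rewrite -[a]repK; apply/eqP/all1.
have /rho_all1 : rho (rep a * rep b) word1 by exact: (cls_eq _ _).1 ab1.
by rewrite /= all_cat eqxx /= => /andP[].
Qed.

Definition F1 : Type := {a : F11 | a \in notunit}.
HB.instance Definition _ := SubChoice.copy F1 {a : F11 | a \in notunit}.
HB.instance Definition _ := SubChoice_isSubSemigroup.Build F11 notunit F1 notunit_mul.

(* Main.v *)
Require Import Defs.
From HB Require Import structures.
From mathcomp Require Import all_boot.
From mathcomp Require Import boolp classical_sets cardinality.
Set Implicit Arguments.
Unset Strict Implicit.
Unset Printing Implicit Defensive.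
Local Open Scope classical_set_scope.
Local Open Scope group_scope.

(** Why the theorem holds.

    Let [k] be in G^5 and let [(c, b)] be [(k^l, k^la)] or [(k^r, k^ra)].  The
    element [c b k] of F_1^1 is treated as an arrow from [k] down to [c]: with
    the reversed word [k b' c] it satisfies [(k b' c)(c b k) = k], so that it
    moves the idempotent [k] to an idempotent below [c].  An element [g] of
    height at least 2 is the same thing as an ordered pair of distinct arrows
    [r : h -> c] and [s : k -> c] with a common target ([object_sandwich]), and
    it comes with two arrows [larr g : g -> k] and [rarr g : g -> h].  Writing
    [E s] for the element of an arrow and [E' s] for the reversed one, the last
    family of defining relations says [E' r * E s = E (rarr g) * E' (larr g)].
    Together with [E' s * E s = src s] this rewrites every product
    [E'(v) E(w)], for two paths [v] and [w] climbing from the same object, into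
    a product [E(a) E'(b)].  The result [(a, b)] is computed by filling a grid
    with squares, and depends on the lists [v] and [w] only ([grid]).

    Fix an object [c] and distinct objects [h_0, ..., h_n] with [h_j^l = c];
    such fans exist for every [n] because squares over the arrows into [c]
    yield more and more arrows into the objects above ([fan]).  Let T be the
    set of all [E(u) E'(v)], where [u] and [v] are nonempty paths with the same
    end that climb from [c] through the fan and through the squares built over
    it.  By the rewriting above T is closed under products, and [E(v) E'(u)] is
    an inverse of [E(u) E'(v)]; so T is a regular subsemigroup of F_1.

    The homomorphism from T to S is built arrow by arrow.  The arrow from [h_j]
    is sent to the [j]-th idempotent of [X].  For a square over [r] and [s]
    whose values are known, the element [a = E' r * E s] of S has to be
    factored as [E (rarr g) * E' (larr g)], and any [t] with [a t a = a]
    provides such a factorisation ([value], [val_fan]).  That the resulting map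
    on T is well defined requires recovering [u] and [v] from the element
    [E(u) E'(v)] of F_1.  For this, pairs of lists of arrows are made a monoid
    by means of [grid], and the defining relations of F_1^1 are checked there;
    the induced homomorphism [theta] sends [E(u) E'(v)] to [u] and [v] preceded
    by prefixes that depend on [c] only ([theta_elem]).

    The image of T is a regular subsemigroup of S that contains [X], so it is
    all of S by weak generation. *)

(** * Arrows and the grid product *)

HB.instance Definition _ := gen_eqMixin A.
HB.instance Definition _ := gen_choiceMixin A.

(** A triple [(c, b, k)] stands for the element [c b k] of F_1^1, read as a
    step from the upper object [k] down to [c]. The type contains meaningless
    triples as well, so that the combinatorics below is free of side
    conditions; [is_arrow] selects the meaningful ones. *)
Definition arrow : Type := (elt * A * elt)%type.
HB.instance Definition _ := Choice.copy arrow (elt * A * elt)%type.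

Definition tgt (s : arrow) : elt := s.1.1.
Definition lab (s : arrow) : A := s.1.2.
Definition src (s : arrow) : elt := s.2.

Definition larr (g : elt) : arrow := (gl g, gla g, g).
Definition rarr (g : elt) : arrow := (gr g, gra g, g).

(** With [r = (c, a, h)] and [s = (c, b, k)] this is the 5-tuple [g] for which
    the last defining relation of F_1^1 reads [(h a' c)(c b k) = (h a' g)(g b
    k)]: the square that replaces the descent from [h] to [c] and the climb to
    [k] by a climb to [g] along [rarr g] and a descent to [k] along [larr
    g]. *)
Definition sandwich (r s : arrow) : elt :=
  Tup (src s) (invA (lab s)) (tgt s) (invA (lab r)) (src r).

(** Push one inverted arrow through a path: a square for each arrow met, until
    the inverted arrow cancels against an equal one or leaves at the far
    end. *)
Fixpoint grid1 (r : arrow) (w : seq arrow) : seq arrow * seq arrow :=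
  if w is s :: w' then
    if r == s then (w', [::])
    else let: (a, b) := grid1 (larr (sandwich r s)) w' in
         (rarr (sandwich r s) :: a, b)
  else ([::], [:: r]).

(** [grid v w = (a, b)] expresses that [v^-1 w] rewrites to [a b^-1]. *)
Fixpoint grid (v w : seq arrow) : seq arrow * seq arrow :=
  if v is r :: v' then
    let: (a, b) := grid1 r w in
    let: (a', b') := grid v' a in (a', b ++ b')
  else (w, [::]).

Lemma grid0r v : grid v [::] = ([::], v).
Proof. by elim: v => //= r v ->. Qed.

Lemma grid1E r w : grid [:: r] w = grid1 r w.
Proof. by rewrite /=; case: grid1 => a b; rewrite cats0. Qed.

(** Cutting the grid horizontally, and vertically in [grid_catr], gives the
    same filling; associativity of the product of zigzags amounts to these two
    facts. *)
Lemma grid_catl v1 v2 w :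
  grid (v1 ++ v2) w =
  ((grid v2 (grid v1 w).1).1, (grid v1 w).2 ++ (grid v2 (grid v1 w).1).2).
Proof.
elim: v1 w => [|r v1 IH] w /=; first by case: grid.
case: grid1 => a b; rewrite IH.
by case: (grid v1 a) => a1 b1 /=; rewrite catA.
Qed.

Lemma grid1_catr r w1 w2 :
  grid1 r (w1 ++ w2) =
  ((grid1 r w1).1 ++ (grid (grid1 r w1).2 w2).1, (grid (grid1 r w1).2 w2).2).
Proof.
elim: w1 r => [|s w1 IH] r; first by rewrite grid1E; case: grid1.
rewrite /=; case: eqP => //= _; rewrite IH.
by case: (grid1 _ w1).
Qed.

Lemma grid_catr v w1 w2 :
  grid v (w1 ++ w2) =
  ((grid v w1).1 ++ (grid (grid v w1).2 w2).1, (grid (grid v w1).2 w2).2).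
Proof.
elim: v w1 w2 => [|r v IH] w1 w2 //=.
rewrite grid1_catr; case: (grid1 r w1) => a1 b1 /=.
case E: (grid b1 w2) => [a2 b2] /=; rewrite IH.
by case: (grid v a1) => a1' b' /=; rewrite grid_catl E.
Qed.

Lemma grid_cancel v w p q :
  grid v w = ([::], [::]) -> grid (v ++ p) (w ++ q) = grid p q.
Proof. by move=> vw; rewrite grid_catl grid_catr vw /=; case: grid. Qed.

Lemma grid_id v : grid v v = ([::], [::]).
Proof. by elim: v => //= r v IH; rewrite eqxx IH. Qed.

(** A pair [(u, v)] stands for the element [u v^-1]: climb along [u] and come
    back down along [v]. Arbitrary lists are allowed, composable or not. *)
Definition zigzag : Type := (seq arrow * seq arrow)%type.
HB.instance Definition _ := Choice.copy zigzag (seq arrow * seq arrow)%type.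

Definition zigzag_mul (p q : zigzag) : zigzag :=
  (p.1 ++ (grid p.2 q.1).1, q.2 ++ (grid p.2 q.1).2).

Lemma zigzag_mulA : associative zigzag_mul.
Proof.
move=> [u v] [w z] [y t]; rewrite /zigzag_mul /= grid_catr grid_catl /=.
by rewrite !catA.
Qed.

Lemma zigzag_mul1 : left_id (([::], [::]) : zigzag) zigzag_mul.
Proof. by case=> u v; rewrite /zigzag_mul /= cats0. Qed.

Lemma zigzag_mulr1 : right_id (([::], [::]) : zigzag) zigzag_mul.
Proof. by case=> u v; rewrite /zigzag_mul /= grid0r cats0. Qed.

HB.instance Definition _ :=
  isMonoid.Build zigzag zigzag_mulA zigzag_mul1 zigzag_mulr1.

(** Its result type makes the product of zigzags available to unification,
    which a bare pair does not. *)
Definition zz (u v : seq arrow) : zigzag := (u, v).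

Lemma zzM u v w z :
  zz u v * zz w z = zz (u ++ (grid v w).1) (z ++ (grid v w).2).
Proof. by []. Qed.

Lemma zigzag_cancel u v w p q z : grid v w = ([::], [::]) ->
  zz u (v ++ p) * zz (w ++ q) z = zz u p * zz q z.
Proof. by move=> vw; rewrite !zzM grid_cancel. Qed.

(** * The 5-tuples are the pairs of distinct arrows with a common target *)

(** The symbols x and x' are not objects: x' is the element of the arrow [rarr
    gxx'], and x is its inverse. *)
Definition object (i : nat) : set elt :=
  if i is 0 then [set Sym A1] else Glev i.

Definition is_arrow (s : arrow) : Prop := s = larr (src s) \/ s = rarr (src s).

Lemma invAK : involutive invA. Proof. by case. Qed.

(** Passing to the next height applies the involution to the two labels and may
    exchange them, so they stay distinct. *)
Lemma Ge_arrows i h : Ge i.+1 h ->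
  [/\ gl h = gr h, gla h <> gra h & object i (gl h)].
Proof.
elim: i h => [|i IH] h; first by move=> ->; split.
move=> [g gi hE]; have [_ la_ra _] := IH _ gi.
suff: [/\ gl h = g, gr h = g & gla h <> gra h].
  by case=> -> -> ?; split=> //; left.
by case: hE => ->; split=> //= /(can_inj invAK) // /esym.
Qed.

Lemma Gd_neq i h : Gd i h -> gl h <> gr h.
Proof. by case: i => [|[|[|i]]] // ; case: h => //= ? ? ? ? ? []. Qed.

(** The conditions that define G_{i,d} describe two arrows with the common
    target [g^c] and with distinct sources, while G_{i,e} collects the
    remaining case, two distinct arrows with the same source. Hence no pair is
    left out. *)
Lemma object_sandwich i g : object i.+2 g <->
  exists r s, [/\ [/\ object i.+1 (src r), object i.+1 (src s),
                      object i (tgt s) & tgt r = tgt s],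
                  is_arrow r, is_arrow s, r <> s & g = sandwich r s].
Proof.
split.
- move=> [[h hi gE]|].
    have [lr la_ra li] := Ge_arrows hi.
    have hi' : object i.+1 h by left.
    have neq : larr h <> rarr h by case.
    case: gE => ->; [exists (rarr h), (larr h)|exists (larr h), (rarr h)];
      split=> //; rewrite /is_arrow /=; auto;
      by rewrite /sandwich /tgt /= -lr.
  case: i => [//|i]; case: g => // l la c ra r [[li ci ri] lr cl cr].
  have -> : Tup l la c ra r = sandwich (c, invA ra, r) (c, invA la, l).
    by rewrite /sandwich /= /src /lab /tgt /= !invAK.
  exists (c, invA ra, r), (c, invA la, l); split=> //.
  + by case: cr => -[-> ->]; rewrite invAK; [left|right].
  + by case: cl => -[-> ->]; rewrite invAK; [left|right].
  + by case=> _ /esym.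
- move=> [r [s [[ri si ci rs] ra sa neq ->]]].
  (* Two distinct arrows from one source [h] force [h^l = h^r], so [h] is in
     [Ge]. *)
  have [e|lr] := pselect (src r = src s).
    have hE : Ge i.+1 (src s).
      case: si => // sd; case: (Gd_neq sd).
      by case: ra sa neq rs => -> [] -> /=; rewrite ?e.
    have [lr la_ra _] := Ge_arrows hE.
    left; exists (src s) => //; rewrite /sandwich e.
    case: ra sa neq => [rE|rE] [sE|sE] neq.
    + by case: neq; rewrite rE sE e.
    + by right; rewrite rE sE e /lab /tgt /= lr.
    + by left; rewrite rE sE e /lab /tgt /=.
    + by case: neq; rewrite rE sE e.
  (* Distinct sources need height at least 2, [gxx'] being alone at height
     1. *)
  case: i ri si ci => [|i] ri si ci.
    by case: ri si lr => [->|//] [->|//].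
  right; split=> //; first by move=> /esym.
  + by case: sa => ->; [left|right].
  + by rewrite -rs; case: ra => ->; [left|right].
Qed.

(** * A homomorphism from F_1^1 to the zigzags *)

Lemma zzK u v w : zz u v * zz v w = zz u w.
Proof. by rewrite zzM grid_id /= !cats0. Qed.

Lemma zigzag_cancell u v w p z : grid v w = ([::], [::]) ->
  zz u (v ++ p) * zz w z = zz u (z ++ p).
Proof.
by move=> vw; rewrite -[w]cats0 zigzag_cancel // zzM grid0r cats0.
Qed.

Lemma zigzag_cancelr u v w q z : grid v w = ([::], [::]) ->
  zz u v * zz (w ++ q) z = zz (u ++ q) z.
Proof. by move=> vw; rewrite -[v]cats0 zigzag_cancel // zzM /= cats0. Qed.

Lemma object_tgt i s : object i.+1 (src s) -> is_arrow s -> object i (tgt s).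
Proof.
move=> si sA; case: i si => [[si|//]|i /object_sandwich].
  by case: sA => ->; rewrite si.
move=> [p [q [[pi qi _ _] _ _ _ e]]].
by case: sA => ->; rewrite e.
Qed.

(** The zigzag of [g] is [(lpath g, rpath g)]. For [g = sandwich r s] with
    centre [c], the relations give [g = c g c] and [g = s (larr g) (rarr g)^-1
    r^-1] inside the local monoid at [c], so the paths of [g] extend those of
    [c]. The element [gxx'], whose centre is the symbol x, equals [x x'], that
    is [l l^-1] for its left arrow [l]; this explains the second clause, which
    is the same in [rpath]. *)
Fixpoint lpath (g : elt) : seq arrow :=
  match g with
  | Sym _ => [::]
  | Tup l la (Sym Ax) ra r => [:: (l, la, g)]
  | Tup l la c ra r => lpath c ++ [:: (c, invA la, l); (l, la, g)]
  end.

Fixpoint rpath (g : elt) : seq arrow :=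
  match g with
  | Sym _ => [::]
  | Tup l la (Sym Ax) ra r => [:: (l, la, g)]
  | Tup l la c ra r => rpath c ++ [:: (c, invA ra, r); (r, ra, g)]
  end.

Definition letter (g : elt) : zigzag :=
  match g with
  | Sym A1 => 1
  | Sym Ax => zz [:: larr gxx'] [:: rarr gxx']
  | Sym Ax' => zz [:: rarr gxx'] [:: larr gxx']
  | Tup _ _ _ _ _ => zz (lpath g) (rpath g)
  end.

Lemma letter_object i g : object i g -> letter g = zz (lpath g) (rpath g).
Proof.
case: g => // -[] //; case: i => [|[|i]] // [] //=; try by move=> [].
- by case=> ? _ [].
- by case: i.
- by case=> ? _ [].
- by case: i.
Qed.

Lemma path_sandwich i r s : object i (tgt s) -> tgt r = tgt s ->
  let g := sandwich r s in
  lpath g = lpath (tgt s) ++ [:: s; larr g] /\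
  rpath g = rpath (tgt s) ++ [:: r; rarr g].
Proof.
case: r => [[c' a] h]; case: s => [[c b] k]; rewrite /tgt /= => ci ->.
rewrite /larr /rarr /sandwich /= /tgt /lab /src /= !invAK.
case: c ci => [[]|] //.
by case: i => [|[|i]] [] //; [case=> ? _ []|case: i].
Qed.

(** An element [c b k] acts as the single step [s], placed between the climbing
    part of [c] and the descending part of [k]. By induction on the height:
    with [d] the centre of [k], [c b k = (c b d) k], and [c b d] is an arrow
    into [d] reversed, whose step either cancels against the first step of [k]
    above [d] or spans with it the square [k]. The last clause is what makes
    consecutive steps compose. *)
Lemma letter_arrow i s : object i.+1 (src s) -> is_arrow s ->
  [/\ letter (tgt s) * letter (Sym (lab s)) * letter (src s) =
        zz (lpath (tgt s) ++ [:: s]) (rpath (src s)),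
      letter (src s) * letter (Sym (invA (lab s))) * letter (tgt s) =
        zz (lpath (src s)) (rpath (tgt s) ++ [:: s])  &
      grid (rpath (src s)) (lpath (src s)) = ([::], [::])].
Proof.
elim/ltn_ind: i s => -[_|i IH] s si sA.
  have e : src s = gxx' by case: si.
  have neq : larr gxx' == rarr gxx' = false by apply/eqP.
  case: sA => ->; rewrite e; split; try exact: grid_id;
    rewrite /= /lab /tgt /src /= ?mul1g ?mulg1 //; exact: zzK.
have /object_sandwich[p [q [[pi qi ci pq] pA qA p_q gE]]] := si.
have [lE rE] := path_sandwich ci pq.
have [q1 q2 _] := IH i (leqnn _) q qi qA.
have [p1 p2 _] := IH i (leqnn _) p pi pA.
move: p1 p2; rewrite pq => p1 p2.
have gg := letter_object si.
have cc : grid (rpath (tgt q)) (lpath (tgt q)) = ([::], [::]).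
  case: i IH ci {si pi qi gg} => [|i] IH ci; first by rewrite ci.
  by have [] := IH i (leqnSn _) (larr (tgt q)) ci (or_introl erefl).
move: gg lE rE; rewrite -gE; move Eg: (src s) => g gg lE rE.
have cg : letter (tgt q) * letter g = letter g.
  rewrite gg (letter_object ci) lE.
  exact: zigzag_cancelr.
have gc : letter g * letter (tgt q) = letter g.
  rewrite gg (letter_object ci) rE.
  exact: zigzag_cancell.
have pqE : (p == q) = false by apply/eqP.
have larrE : larr (sandwich p q) = larr g by rewrite -gE Eg.
have rarrE : rarr (sandwich p q) = rarr g by rewrite -gE Eg.
have gE' : g = sandwich p q by rewrite -gE Eg.
have comps : [/\ gl g = src q, gla g = invA (lab q), gr g = src p
   & gra g = invA (lab p)] by rewrite gE'.
have [glE glaE grE graE] := comps.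
split.
- rewrite -cg !mulgA gg.
  have : s = larr g \/ s = rarr g by rewrite -Eg.
  case=> ->; rewrite /tgt /lab /= ?glE ?glaE ?grE ?graE ?q2 ?p2 lE rE.
  + by rewrite zigzag_cancel // zzM /= eqxx /= cats0.
  + by rewrite zigzag_cancel // zzM /= pqE /= larrE rarrE eqxx /= cats0.
- move: q1 p1; rewrite -gc -!mulgA gg => q1 p1.
  have : s = larr g \/ s = rarr g by rewrite -Eg.
  case=> ->; rewrite /tgt /lab /= ?glE ?glaE ?grE ?graE !invAK.
  + rewrite q1 lE rE zigzag_cancel // zzM /= pqE /= larrE rarrE.
    by rewrite eqxx /= cats0.
  + by rewrite p1 lE rE zigzag_cancel // zzM /= eqxx /= cats0.
- by rewrite lE rE grid_cancel //= pqE /= larrE rarrE eqxx /= eqxx.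
Qed.

Definition eval (w : seq elt) : zigzag := foldr (fun g z => letter g * z) 1 w.

Lemma eval_cat u v : eval (u ++ v) = eval u * eval v.
Proof. by elim: u => [|g u IH] /=; rewrite ?mul1g // IH mulgA. Qed.

Lemma letter_idem i g : object i g -> letter g * letter g = letter g.
Proof.
case: i => [|i] gi; first by rewrite gi mul1g.
have [_ _ gK] := letter_arrow (s := larr g) gi (or_introl erefl).
by rewrite (letter_object gi) zzM gK !cats0.
Qed.

(** The three families of relations for height at least 2 hold among zigzags,
    by splitting each side into elements of the form [c b k] or [k b' c] and
    composing the corresponding steps. *)
Lemma letter_relations i g : object i.+2 g ->
  let k := letter (gl g) in let h := letter (gr g) in let c := letter (gc g) in
  let b := letter (Sym (invA (gla g))) in let b' := letter (Sym (gla g)) in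
  let a := letter (Sym (invA (gra g))) in let a' := letter (Sym (gra g)) in
  [/\ c * b * k * b' * letter g = letter g,
      letter g * a * h * a' * c = letter g &
      h * a' * letter g * b * k = h * a' * c * b * k].
Proof.
move=> gi.
have /object_sandwich[r [s [[ri si ci rs] rA sA r_s gE]]] := gi.
have [l1 l2 lK] := letter_arrow (s := larr g) gi (or_introl erefl).
have [r1 r2 _] := letter_arrow (s := rarr g) gi (or_intror erefl).
have [s1 _ sK] := letter_arrow si sA.
have [_ p2 pK] := letter_arrow ri rA.
have [lE rE] := path_sandwich ci rs.
have gg := letter_object gi.
move: (letter_idem gi) (letter_idem si) (letter_idem ri) (letter_idem ci)
  => g2 s_2 r_2 c2.
have comps : [/\ gl g = src s, gla g = invA (lab s), gr g = src r,
   gra g = invA (lab r) & gc g = tgt s] by rewrite gE.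
have [glE glaE grE graE gcE] := comps.
rewrite -gE in lE rE.
have r_sE : (r == s) = false by apply/eqP.
move: l1 l2 r1 r2; rewrite /tgt /lab /src /= -/(src s) -/(src r).
rewrite glE glaE grE graE gcE !invAK => l1 l2 r1 r2.
rewrite rs in p2.
split.
- rewrite -[in LHS]s_2 !mulgA s1 -!mulgA [_ * (_ * letter g)]mulgA l1 gg lE.
  by rewrite zigzag_cancelr // -catA.
- rewrite -[in LHS]r_2 !mulgA r2 -!mulgA [letter (src r) * _]mulgA p2 gg rE.
  by rewrite zigzag_cancell // -catA.
- rewrite -[in LHS]g2 -[in RHS]c2 !mulgA r1 p2 -!mulgA.
  rewrite [letter g * _]mulgA [letter (tgt s) * _]mulgA l2 s1.
  rewrite [in LHS]zzM lK !cats0 zigzag_cancel ?zzM /= ?r_sE -?gE //.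
  case: i ci {gi si ri g2 gg} => [|i] ci; first by rewrite ci.
  by have [] := letter_arrow (s := larr (tgt s)) ci (or_introl erefl).
Qed.

Lemma eval_relator u v : relator u v -> eval u = eval v.
Proof.
case=> {u v}.
- by rewrite /= !mulg1 !zzK.
- by rewrite /= !mulg1 !zzK.
- by rewrite /= !mulg1 zzK.
- by move=> g _; rewrite /= mul1g.
- by move=> g _; rewrite /= mul1g.
- move=> g gG; rewrite /= !mulg1; case: gG => [[[//|i] /= i1 gi]|->].
    exact: (letter_idem (i := i.+1)).
  exact: mulg1.
- case=> [//|[//|i]] g _ gi; have [rel _ _] := letter_relations (i := i) gi.
  by rewrite /= mulg1 !mulgA.
- case=> [//|[//|i]] g _ gi; have [_ rel _] := letter_relations (i := i) gi.
  by rewrite /= !mulg1 !mulgA.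
- case=> [//|[//|i]] g _ gi; have [_ _ rel] := letter_relations (i := i) gi.
  by rewrite /= !mulg1 !mulgA.
Qed.

Definition theta (a : F11) : zigzag := eval (val (rep a)).

Lemma theta_cls u : theta (cls u) = eval (val u).
Proof.
suff: rho (rep (cls u)) u.
  pose R (a b : Gplus) := eval (val a) = eval (val b).
  move=> uv; apply: (uv R) => [|a b]; last exact: eval_relator.
  split=> [//|a b|a b c ab bc|a b c d ab cd]; first exact: esym.
    exact: etrans ab bc.
  by rewrite /R /= !eval_cat ab cd.
by apply/cls_eq; rewrite repK.
Qed.

Lemma thetaM a b : theta (a * b) = theta a * theta b.
Proof. by rewrite /mul /= /F11_mul theta_cls /= eval_cat. Qed.

(** The class of a word, extended by 1 to the words outside G^+ so that it can
    be computed letter by letter without membership proofs. *)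
Definition wcls (w : seq elt) : F11 :=
  if insub w is Some u then cls u else 1.

Lemma wclsE w (wG : w \in Gword) : wcls w = cls (word wG).
Proof.
rewrite /wcls; case: insubP => [u _ uw|]; last by rewrite wG.
by congr cls; apply: val_inj.
Qed.

Lemma wcls_cons g w : G g -> w \in Gword ->
  wcls (g :: w) = wcls [:: g] * wcls w.
Proof.
move=> gG wG; have g1 : [:: g] \in Gword.
  by rewrite inE; split=> // h; rewrite mem_seq1 => /eqP->.
rewrite (wclsE g1) (wclsE wG) (wclsE (Gword_cat g1 wG)) /mul /= F11_mulE.
by congr cls; apply: val_inj.
Qed.

Definition gen (g : elt) : F11 := wcls [:: g].

Lemma wcls_foldr w : w \in Gword ->
  wcls w = foldr (fun g a => gen g * a) 1 w.
Proof.
rewrite inE => -[_]; elim: w => [|g w IH] wG.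
  rewrite /= /wcls; case: insubP => //= u.
  by rewrite inE => -[].
have gG : G g by apply: wG; rewrite in_cons eqxx.
have wG' h : h \in w -> G h by move=> hw; apply: wG; rewrite in_cons hw orbT.
rewrite /= -IH //; case: w {IH wG} wG' => [|h w] wG.
  by rewrite {2}/wcls; case: insubP => [u|_]; rewrite ?mulg1 // inE => -[].
by apply: wcls_cons => //; rewrite inE.
Qed.

Lemma gen_relator u v : relator u v ->
  foldr (fun g a => gen g * a) 1 u = foldr (fun g a => gen g * a) 1 v.
Proof.
move=> uv; have [uG vG] := relator_Gword uv.
rewrite -!wcls_foldr // (wclsE uG) (wclsE vG); apply/cls_eq.
exact: smallest_congruence_sub.
Qed.

Lemma theta_gen g : G g -> theta (gen g) = letter g.
Proof.
move=> gG; have g1 : [:: g] \in Gword.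
  by rewrite inE; split=> // h; rewrite mem_seq1 => /eqP->.
by rewrite /gen (wclsE g1) theta_cls /= mulg1.
Qed.

Lemma gen1 : gen (Sym A1) = 1.
Proof. by rewrite /gen (wclsE (Sym_Gword A1)). Qed.

Lemma gen_idem i g : object i g -> gen g * gen g = gen g.
Proof.
move=> gi; have gG' : G' g.
  by case: i gi => [->|i gi]; [right|left; exists i.+1].
by have := gen_relator (rel_gg gG'); rewrite /= !mulg1.
Qed.

Lemma gen_relations i g : object i.+2 g ->
  let k := gen (gl g) in let h := gen (gr g) in let c := gen (gc g) in
  let b := gen (Sym (invA (gla g))) in let b' := gen (Sym (gla g)) in
  let a := gen (Sym (invA (gra g))) in let a' := gen (Sym (gra g)) in
  [/\ c * b * k * b' * gen g = gen g,
      gen g * a * h * a' * c = gen g &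
      h * a' * gen g * b * k = h * a' * c * b * k].
Proof.
move=> gi; have i2 : (2 <= i.+2)%N by [].
split.
- by have := gen_relator (rel_L i2 gi); rewrite /= !mulg1 !mulgA.
- by have := gen_relator (rel_R i2 gi); rewrite /= !mulg1 !mulgA.
- by have := gen_relator (rel_LR i2 gi); rewrite /= !mulg1 !mulgA.
Qed.

(** Paths climb: an arrow is entered through its target and left through its
    source. *)
Fixpoint is_path (V : arrow -> Prop) (c : elt) (u : seq arrow) : Prop :=
  if u is s :: u' then [/\ V s, tgt s = c & is_path V (src s) u'] else True.

Definition path_end (c : elt) (u : seq arrow) : elt := last c (map src u).

Lemma is_path_cat V c u v :
  is_path V c (u ++ v) <-> is_path V c u /\ is_path V (path_end c u) v.
Proof.
elim: u c => [|s u IH] c /=; first by split=> [|[]].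
split=> [[Vs sc /IH[]]|[[Vs sc cu] uv]] //.
by split=> //; apply/IH.
Qed.

Lemma path_end_cat c u v : path_end c (u ++ v) = path_end (path_end c u) v.
Proof. by rewrite /path_end map_cat last_cat. Qed.

Definition sandwich_closed (V : arrow -> Prop) : Prop :=
  forall r s, V r -> V s -> r <> s -> tgt r = tgt s ->
    V (larr (sandwich r s)) /\ V (rarr (sandwich r s)).

(** The relations between arrows in F_1^1, isolated so that they can be checked
    both there and in the semigroup onto which a map is to be constructed. The
    idempotent [J c] is the identity of the object [c]. *)
Record interpretation (N : monoidType) (V : arrow -> Prop)
    (J : elt -> N) (E E' : arrow -> N) : Prop := Interpretation {
  interp_tgtE s : V s -> J (tgt s) * E s = E s;
  interp_Esrc s : V s -> E s * J (src s) = E s;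
  interp_srcE' s : V s -> J (src s) * E' s = E' s;
  interp_E'tgt s : V s -> E' s * J (tgt s) = E' s;
  interp_E'E s : V s -> E' s * E s = J (src s);
  interp_sandwich r s : V r -> V s -> r <> s -> tgt r = tgt s ->
    E' r * E s = E (rarr (sandwich r s)) * E' (larr (sandwich r s)) }.

Section Interpretation.
Variables (N : monoidType) (V : arrow -> Prop).
Variables (J : elt -> N) (E E' : arrow -> N).

(** The empty path is interpreted by [J c] and not by 1, since [E' s * E s] is
    only the identity of the source of [s]. *)
Fixpoint climb (c : elt) (u : seq arrow) : N :=
  if u is s :: u' then E s * climb (src s) u' else J c.

Fixpoint descend (c : elt) (v : seq arrow) : N :=
  if v is s :: v' then descend (src s) v' * E' s else J c.

Hypothesis V_closed : sandwich_closed V.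
Hypothesis I : interpretation V J E E'.

Lemma src_idem s : V s -> J (src s) * J (src s) = J (src s).
Proof.
move=> Vs; rewrite -{1}(interp_E'E I Vs) -mulgA (interp_Esrc I) //.
exact: interp_E'E I _ Vs.
Qed.

Lemma end_idem c u : J c * J c = J c -> is_path V c u ->
  J (path_end c u) * J (path_end c u) = J (path_end c u).
Proof.
by elim: u c => [//|s u IH] c _ [Vs _ cu]; apply: IH => //; exact: src_idem.
Qed.

Lemma climb_start c u : J c * J c = J c -> is_path V c u ->
  J c * climb c u = climb c u.
Proof.
by case: u => [//|s u] _ [Vs <- _]; rewrite /= mulgA (interp_tgtE I).
Qed.

Lemma descend_start c v : J c * J c = J c -> is_path V c v ->
  descend c v * J c = descend c v.
Proof.
by case: v => [//|s v] _ [Vs <- _]; rewrite /= -mulgA (interp_E'tgt I).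
Qed.

Lemma climb_cat c u v : J c * J c = J c -> is_path V c (u ++ v) ->
  climb c (u ++ v) = climb c u * climb (path_end c u) v.
Proof.
elim: u c => [|s u IH] c JJ /=; first by move=> cv; rewrite climb_start.
by move=> [Vs _ uv]; rewrite IH ?mulgA //; exact: src_idem.
Qed.

Lemma descend_cat c u v : J c * J c = J c -> is_path V c (u ++ v) ->
  descend c (u ++ v) = descend (path_end c u) v * descend c u.
Proof.
elim: u c => [|s u IH] c JJ /=; first by move=> cv; rewrite descend_start.
by move=> [Vs _ uv]; rewrite IH ?mulgA //; exact: src_idem.
Qed.

Lemma climb_end c u : J c * J c = J c -> is_path V c u ->
  climb c u * J (path_end c u) = climb c u.
Proof.
by move=> JJ cu; rewrite -[in RHS](cats0 u) climb_cat // cats0.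
Qed.

Lemma grid1_interp r w : V r -> J (tgt r) * J (tgt r) = J (tgt r) ->
  is_path V (tgt r) w -> let: (a, b) := grid1 r w in
  [/\ is_path V (src r) a, is_path V (path_end (tgt r) w) b,
      path_end (src r) a = path_end (path_end (tgt r) w) b &
      E' r * climb (tgt r) w =
        climb (src r) a * descend (path_end (tgt r) w) b].
Proof.
elim: w r => [|s w IH] r Vr JJ.
  move=> _ /=; split=> //.
  rewrite (interp_E'tgt I) // mulgA src_idem //; exact/esym/(interp_srcE' I).
move=> [Vs sr rw] /=; case: eqP => [rs|r_s].
  rewrite rs; split=> //; rewrite mulgA (interp_E'E I) //.
  rewrite climb_start //; last exact: src_idem.
  by rewrite [RHS]climb_end //; exact: src_idem.
have [Vl Vr'] := V_closed Vr Vs r_s (esym sr).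
have := IH _ Vl (src_idem Vs) rw.
case: grid1 => a b [pa pb ab eq]; split=> //.
by rewrite mulgA (interp_sandwich I) // -!mulgA; congr (_ * _).
Qed.

(** The rewriting encoded by [grid] is valid in every interpretation, and it
    keeps paths composable. *)
Lemma grid_interp c v w : J c * J c = J c -> is_path V c v -> is_path V c w ->
  let: (a, b) := grid v w in
  [/\ is_path V (path_end c v) a, is_path V (path_end c w) b,
      path_end (path_end c v) a = path_end (path_end c w) b &
      descend c v * climb c w =
        climb (path_end c v) a * descend (path_end c w) b].
Proof.
elim: v c w => [|r v IH] c w JJ.
  by move=> _ cw /=; split=> //; rewrite climb_start // [RHS]climb_end.
move=> [Vr rc rv] cw /=; subst c.
have := grid1_interp Vr JJ cw; case: grid1 => a b [pa pb ab eq1].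
have := IH _ _ (src_idem Vr) rv pa; case: grid => a' b' [pa' pb' ab' eq2].
have bb : is_path V (path_end (tgt r) w) (b ++ b').
  by apply/is_path_cat; split=> //; rewrite -ab.
split=> //; first by rewrite path_end_cat -ab.
rewrite -mulgA eq1 mulgA eq2 descend_cat //; last exact: end_idem.
by rewrite -mulgA -ab.
Qed.

Definition elem (c : elt) (u v : seq arrow) : N := climb c u * descend c v.

Definition parallel (c : elt) (u v : seq arrow) : Prop :=
  [/\ is_path V c u, is_path V c v & path_end c u = path_end c v].

Lemma elemM c u v w z : J c * J c = J c -> parallel c u v -> parallel c w z ->
  parallel c (u ++ (grid v w).1) (z ++ (grid v w).2) /\
  elem c u v * elem c w z = elem c (u ++ (grid v w).1) (z ++ (grid v w).2).
Proof.
move=> JJ [cu cv uv] [cw cz wz]; have := grid_interp JJ cv cw.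
case: grid => a b /= [pa pb ab eq].
have cua : is_path V c (u ++ a) by apply/is_path_cat; rewrite uv.
have czb : is_path V c (z ++ b) by apply/is_path_cat; rewrite -wz.
split; first by split=> //; rewrite !path_end_cat uv -wz.
rewrite /elem -mulgA [descend c v * _]mulgA eq climb_cat // descend_cat //.
by rewrite uv -wz !mulgA.
Qed.

(** Swapping the two paths gives an inverse because [grid v v] is empty. *)
Lemma elem_regular c u v : J c * J c = J c -> parallel c u v ->
  elem c u v * elem c v u * elem c u v = elem c u v.
Proof.
move=> JJ uv; have [cu cv uvE] := uv; have vu : parallel c v u by [].
have [uu ->] := elemM JJ uv vu; rewrite grid_id !cats0.
by have [_ ->] := elemM JJ (And3 cu cu erefl) uv; rewrite grid_id !cats0.
Qed.
End Interpretation.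

(** Below height 2 there are no defining relations that involve [g^L] and
    [g^R], so these arrows are the ones to which the interpretation applies. *)
Definition high_arrow (s : arrow) : Prop :=
  is_arrow s /\ exists i, object i.+2 (src s).

Definition genE (s : arrow) : F11 :=
  gen (tgt s) * gen (Sym (lab s)) * gen (src s).
Definition genE' (s : arrow) : F11 :=
  gen (src s) * gen (Sym (invA (lab s))) * gen (tgt s).

(** The first two families of relations yield [g c = c g = g] for the centre
    [c] of [g], and then [g b k b' g = g] for both arrows of [g]; the third
    family is the rule for squares. *)
Lemma gen_interpretation (V : arrow -> Prop) : sandwich_closed V ->
  (forall s, V s -> high_arrow s) -> interpretation V gen genE genE'.
Proof.
move=> Vc Vh.
have idem s : V s -> [/\ gen (src s) * gen (src s) = gen (src s) &
    gen (tgt s) * gen (tgt s) = gen (tgt s)].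
  move=> /Vh[sA [i si]]; split; first exact: gen_idem si.
  exact: gen_idem (object_tgt si sA).
split=> [s /idem[k2 c2]|s /idem[k2 c2]|s /idem[k2 c2]|s /idem[k2 c2]|s|
         r s Vr Vs r_s rs].
(* The absorption laws hold because objects are idempotents. *)
- by rewrite /genE !mulgA c2.
- by rewrite /genE -!mulgA k2.
- by rewrite /genE' !mulgA k2.
- by rewrite /genE' -!mulgA c2.
- move=> Vs; have [sA [i si]] := Vh _ Vs; have [k2 t2] := idem _ Vs.
  have := gen_relations si; case=> L R _.
  have c2 : gen (gc (src s)) * gen (gc (src s)) = gen (gc (src s)).
    have /object_sandwich[p [q [[_ _ ci _] _ _ _ ->]]] := si.
    exact: gen_idem ci.
  have cg : gen (gc (src s)) * gen (src s) = gen (src s).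
    by rewrite -L !mulgA c2.
  have gc : gen (src s) * gen (gc (src s)) = gen (src s).
    by rewrite -R -!mulgA c2.
  have cases : tgt s = gl (src s) /\ lab s = gla (src s) \/
               tgt s = gr (src s) /\ lab s = gra (src s).
    by case: sA => ->; [left|right].
  rewrite /genE' /genE -!mulgA [gen (tgt s) * (gen (tgt s) * _)]mulgA t2.
  case: cases => -[-> ->].
  + by rewrite -{1}gc -!mulgA; rewrite -!mulgA in L; rewrite L k2.
  + by rewrite -{2}cg !mulgA R k2.
- have [Vl _] := Vc _ _ Vr Vs r_s rs; have [_ [i gi]] := Vh _ Vl.
  have [_ c2] := idem _ Vs; have [g2 _] := idem _ Vl.
  have [_ _] := gen_relations gi.
  set g := src _ in gi g2 *.
  have [-> -> -> ->] : [/\ gr g = src r, gra g = invA (lab r), gl g = src s &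
    invA (gla g) = lab s] by rewrite /= invAK.
  have -> : gc g = tgt s by [].
  have -> : genE (rarr (sandwich r s)) =
    gen (src r) * gen (Sym (invA (lab r))) * gen g by [].
  have -> : genE' (larr (sandwich r s)) =
    gen g * gen (Sym (lab s)) * gen (src s).
    by rewrite /genE' /= /lab /= invAK.
  rewrite /genE /genE' rs -!mulgA => LR.
  rewrite [gen (tgt s) * (gen (tgt s) * _)]mulgA c2 -LR.
  by rewrite [gen g * (gen g * _)]mulgA g2.
Qed.

Lemma genE_theta s : high_arrow s ->
  theta (genE s) = zz (lpath (tgt s) ++ [:: s]) (rpath (src s)) /\
  theta (genE' s) = zz (lpath (src s)) (rpath (tgt s) ++ [:: s]).
Proof.
move=> [sA [i si]]; have [e e' _] := letter_arrow si sA.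
have kG : G (src s) by apply: (@G_Glev i.+2).
have cG : G (tgt s) by apply: (@G_Glev i.+1); exact: object_tgt si sA.
by rewrite /genE /genE' !thetaM !theta_gen //; exact: G_Sym.
Qed.

Lemma theta_climb_descend (V : arrow -> Prop) i c u :
  (forall s, V s -> high_arrow s) -> object i.+1 c -> is_path V c u ->
  [/\ theta (climb gen genE c u) = zz (lpath c ++ u) (rpath (path_end c u)),
      theta (descend gen genE' c u) = zz (lpath (path_end c u)) (rpath c ++ u) &
      grid (rpath (path_end c u)) (lpath (path_end c u)) = ([::], [::])].
Proof.
move=> Vh; elim: u i c => [|s u IH] i c ci.
  have cG : G c by apply: (@G_Glev i.+1).
  move=> _; rewrite /= theta_gen // (letter_object ci) !cats0; split=> //.
  by have [] := letter_arrow (s := larr c) ci (or_introl erefl).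
move=> [Vs sc su]; have sh := Vh _ Vs; have [sA [j sj]] := sh.
have [IH1 IH2 IH3] := IH _ _ sj su; have [e e'] := genE_theta sh.
have [_ _ kk] := letter_arrow sj sA.
split; [rewrite /=|rewrite /=|exact: IH3]; rewrite thetaM ?IH1 ?IH2 ?e ?e' sc.
  by rewrite zigzag_cancelr // -catA.
by rewrite zigzag_cancell // -catA.
Qed.

(** The two paths can be read off from the element they represent: [theta] only
    adds the prefixes [lpath c] and [rpath c]. *)
Lemma theta_elem (V : arrow -> Prop) i c u v :
  (forall s, V s -> high_arrow s) -> object i.+1 c -> parallel V c u v ->
  theta (elem gen genE genE' c u v) = zz (lpath c ++ u) (rpath c ++ v).
Proof.
move=> Vh ci [cu cv uv]; rewrite /elem thetaM.
have [-> _ ee] := theta_climb_descend Vh ci cu.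
have [_ -> _] := theta_climb_descend Vh ci cv.
by rewrite -uv zzM ee !cats0.
Qed.

(** * Many arrows into one object *)

Fixpoint height (g : elt) : nat :=
  if g is Tup l _ _ _ _ then (height l).+1 else 0.

Lemma height_object i g : object i g -> height g = i.
Proof.
elim/ltn_ind: i g => -[|[|i]] IH g; first by move=> ->.
  by case=> [->|].
move=> /object_sandwich[r [s [[_ si _ _] _ _ _ ->]]] /=.
by rewrite (IH _ _ _ si).
Qed.

Lemma sandwich_inj r s r' s' : tgt r = tgt s -> tgt r' = tgt s' ->
  sandwich r s = sandwich r' s' -> r = r' /\ s = s'.
Proof.
case: r => [[? ?] ?]; case: s => [[? ?] ?]; case: r' => [[? ?] ?].
case: s' => [[? ?] ?]; rewrite /sandwich /tgt /src /lab /= => -> ->.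
by case=> -> /(can_inj invAK) -> -> /(can_inj invAK) -> ->.
Qed.

Lemma sandwich_object i r s : object i.+2 (src r) -> object i.+2 (src s) ->
  is_arrow r -> is_arrow s -> r <> s -> tgt r = tgt s ->
  object i.+3 (sandwich r s).
Proof.
move=> ri si rA sA r_s rs; apply/object_sandwich; exists r, s.
by split=> //; split=> //; exact: object_tgt.
Qed.

Definition arrows_into (i : nat) (c : elt) (ss : seq arrow) : Prop :=
  [/\ object i.+1 c, uniq ss &
      forall s, s \in ss -> [/\ is_arrow s, tgt s = c & object i.+2 (src s)]].

(** Pair a fixed arrow [t] with each of the others, in both orders. Every
    resulting square has an arrow to the source of [t], so [m + 1] arrows give
    [2 m]. *)
Lemma arrows_into_sandwich i c t ss : arrows_into i c (t :: ss) ->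
  arrows_into i.+1 (src t) ([seq larr (sandwich s t) | s <- ss] ++
                            [seq rarr (sandwich t s) | s <- ss]).
Proof.
move=> [ci /= /andP[tss Uss] ssA].
have [tA tc ti] := ssA t (mem_head _ _).
have {}ssA s : s \in ss ->
    [/\ s <> t, is_arrow s, tgt s = c & object i.+2 (src s)].
  move=> sss; have [sA sc si] := ssA s (@mem_behead _ (t :: ss) _ sss).
  by split=> // e; rewrite -e sss in tss.
split=> //.
- rewrite cat_uniq !map_inj_in_uniq ?Uss ?andbT //=.
  + apply/hasPn => _ /mapP[s sss ->]; apply/negP => /mapP[s' s'ss].
    have [s_t _ sc _] := ssA _ sss; have [s't _ s'c _] := ssA _ s'ss.
    move=> /(congr1 src) e.
    have [] := sandwich_inj (etrans tc (esym sc)) (etrans s'c (esym tc)) e.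
    by move=> /esym.
  + move=> s s' /ssA[_ _ sc _] /ssA[_ _ s'c _] /(congr1 src) e.
    by have [] := sandwich_inj (etrans tc (esym sc)) (etrans tc (esym s'c)) e.
  + move=> s s' /ssA[_ _ sc _] /ssA[_ _ s'c _] /(congr1 src) e.
    by have [] := sandwich_inj (etrans sc (esym tc)) (etrans s'c (esym tc)) e.
- move=> p; rewrite mem_cat => /orP[] /mapP[s /ssA[s_t sA sc si] ->].
  + split=> //; first by left.
    by apply: sandwich_object => //; rewrite sc.
  + split=> //; first by right.
    by apply: sandwich_object => //; [move=> /esym|rewrite sc].
Qed.

(** The doubling makes progress only from three arrows on, and the object 1 has
    two. Its two arrows come from [gxx'] and give two squares, hence arrows
    into [gxx']. *)
Lemma arrows_into_gxx' : exists ss, arrows_into 0 gxx' ss /\ size ss = 3.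
Proof.
have e1 : object 1 gxx' by left.
pose p := larr gxx'; pose q := rarr gxx'.
have pq : p <> q by [].
have h1 : object 2 (sandwich p q).
  by apply/object_sandwich; exists p, q; split=> //; by [left|right].
have h2 : object 2 (sandwich q p).
  apply/object_sandwich; exists q, p; split=> //;
  by [left|right|move=> /esym].
exists [:: larr (sandwich p q); rarr (sandwich p q); larr (sandwich q p)].
split=> //; split=> //.
- by rewrite /= !inE !negb_or !andbT -!andbA; apply/and3P; split; apply/eqP.
- move=> s; rewrite !inE => /or3P[] /eqP->; split=> //; by [left|right].
Qed.

Lemma many_arrows n : exists i c ss, arrows_into i c ss /\ (n + 3 <= size ss)%N.
Proof.
elim: n => [|n [i [c [ss [ssA n_ss]]]]].
  by have [ss [ssA <-]] := arrows_into_gxx'; exists 0, gxx', ss.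
case: ss ssA n_ss => [|t ss] ssA n_ss; first by rewrite addnC in n_ss.
exists i.+1, (src t); eexists; split; first exact: arrows_into_sandwich ssA.
rewrite size_cat !size_map; move: n_ss => /=.
rewrite !addnS !addn0 ltnS => n_ss.
apply: leq_trans (leq_add n_ss n_ss); by rewrite addnS addSn !ltnS leq_addl.
Qed.

(** Squares of different arrows with the same [t] are different objects, so one
    more pairing turns many arrows into arrows with distinct sources. *)
Lemma fan n : exists i c hs, [/\ object i.+1 c, uniq hs, size hs = n &
  forall h, h \in hs -> object i.+2 h /\ gl h = c].
Proof.
have [i [c [[|t ss] [[ci Uss ssA] n_ss]]]] := many_arrows n.
  by rewrite addnC in n_ss.
have [tA tc ti] := ssA t (mem_head _ _).
move: Uss => /= /andP[tss Uss].
have {}ssA s : s \in take n ss ->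
    [/\ s <> t, is_arrow s, tgt s = c & object i.+2 (src s)].
  move=> /mem_take sss.
  have [sA sc si] := ssA s (@mem_behead _ (t :: ss) _ sss).
  by split=> // e; rewrite -e sss in tss.
exists i.+1, (src t), [seq sandwich s t | s <- take n ss]; split=> //.
- rewrite map_inj_in_uniq ?take_uniq //.
  move=> s s' /ssA[_ _ sc _] /ssA[_ _ s'c _] e.
  by have [] := sandwich_inj (etrans sc (esym tc)) (etrans s'c (esym tc)) e.
- rewrite size_map size_takel //.
  by move: n_ss; rewrite /= addnS ltnS; apply: leq_trans; exact: leq_addr.
- move=> _ /mapP[s /ssA[s_t sA sc si] ->]; split=> //.
  by apply: sandwich_object => //; rewrite sc.
Qed.

(** * The regular subsemigroup over a fan and its homomorphism *)

(** An identity is adjoined to serve as the identity of the object [c] at the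
    bottom of the fan, because the values of the fan arrows need not have a
    common idempotent above them. *)
Definition with_unit (S : semigroupType) : Type := option S.
HB.instance Definition _ (S : semigroupType) :=
  Choice.copy (with_unit S) (option S).

Definition with_unit_mul (S : semigroupType) (a b : with_unit S) :
    with_unit S :=
  match a, b with
  | Some a, Some b => Some (a * b)
  | None, _ => b
  | _, None => a
  end.

Lemma with_unit_mulA S : associative (@with_unit_mul S).
Proof. by case=> [a|] [b|] [c|] //=; rewrite mulgA. Qed.

Lemma with_unit_mul1 S : left_id None (@with_unit_mul S).
Proof. by []. Qed.

Lemma with_unit_mulr1 S : right_id None (@with_unit_mul S).
Proof. by case. Qed.

HB.instance Definition _ (S : semigroupType) :=
  isMonoid.Build (with_unit S)
    (@with_unit_mulA S) (@with_unit_mul1 S) (@with_unit_mulr1 S).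

Definition wu (S : semigroupType) (a : S) : with_unit S := Some a.

Lemma wuM (S : semigroupType) (a b : S) : wu a * wu b = wu (a * b).
Proof. by []. Qed.

Section Fan.
Variables (i : nat) (c : elt) (hs : seq elt).
Hypothesis ci : object i.+1 c.
Hypothesis hsP : forall h, h \in hs -> object i.+2 h /\ gl h = c.

Inductive fan_arrow : arrow -> Prop :=
| fan_base h : h \in hs -> fan_arrow (larr h)
| fan_larr r s : fan_arrow r -> fan_arrow s -> r <> s -> tgt r = tgt s ->
    fan_arrow (larr (sandwich r s))
| fan_rarr r s : fan_arrow r -> fan_arrow s -> r <> s -> tgt r = tgt s ->
    fan_arrow (rarr (sandwich r s)).

Lemma fan_closed : sandwich_closed fan_arrow.
Proof. by move=> r s *; split; constructor. Qed.

(** Arrows with the same target have sources of the same height, by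
    [height_object], so that the 5-tuple of the square they span lies in G at
    the next level. *)
Lemma fan_level s : fan_arrow s ->
  is_arrow s /\ exists2 j, (i <= j)%N & object j.+2 (src s).
Proof.
have key r q : is_arrow r /\ (exists2 j, (i <= j)%N & object j.+2 (src r)) ->
    is_arrow q /\ (exists2 j, (i <= j)%N & object j.+2 (src q)) ->
    r <> q -> tgt r = tgt q ->
    exists2 j, (i <= j)%N & object j.+2 (sandwich r q).
  move=> [rA [j ij rj]] [qA [k _ qk]] r_q rq.
  have jk : j = k.
    have := height_object (object_tgt rj rA).
    by rewrite rq (height_object (object_tgt qk qA)) => -[].
  by exists j.+1; [exact: leqW|apply: sandwich_object => //; rewrite jk].
elim=> {s} [h /hsP[hi _]|r s rV IHr sV IHs r_s rs|r s rV IHr sV IHs r_s rs].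
- by split; [left|exists i].
- by split; [left|exact: key].
- by split; [right|exact: key].
Qed.

Lemma fan_high s : fan_arrow s -> high_arrow s.
Proof. by move=> /fan_level[sA [j _ sj]]; split=> //; exists j. Qed.

Lemma height_src s : fan_arrow s -> (i.+2 <= height (src s))%N.
Proof. by move=> /fan_level[_ [j ij /height_object->]]. Qed.

Lemma sandwich_notin r s : fan_arrow s -> sandwich r s \notin hs.
Proof.
move=> /height_src si; apply/negP => /hsP[/height_object /= [e] _].
by rewrite e ltnn in si.
Qed.

Lemma src_neq s : fan_arrow s -> src s <> c.
Proof.
by move=> /height_src + e; rewrite e (height_object ci) ltnn.
Qed.

Section Values.
Variables (S : semigroupType) (inv : S -> S) (xi : elt -> S).
Hypothesis invP : forall a, a * inv a * a = a.
Hypothesis xi_idem : forall h, xi h * xi h = xi h.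

(** The pairs [(E s, E' s)] for an arrow [s] from [k], the argument being the
    target and the label of [s]. The fan object [h] gives [(xi h, xi h)]. At a
    square, [a = E' r * E s] is factored as [a * (t * a)]; the idempotent [t *
    a] is to be the identity of the square. The factors [E' s * E s] and [E' r
    * E r] are inserted to make the values compatible with the identities of
    the two targets. The recursion is structural since [r] and [s] start from
    components of [k]. *)
Fixpoint value (k : elt) : elt * A -> S * S :=
  match k with
  | Sym _ => fun _ => (xi k, xi k)
  | Tup l la d ra r => fun b =>
      if k \in hs then (xi k, xi k) else
      let s := value l (d, invA la) in
      let r := value r (d, invA ra) in
      let a := r.2 * s.1 in
      let t := inv a in
      if b == (l, la) then (s.2 * s.1 * (t * a), t * a)
      else (a, t * a * t * (r.2 * r.1))
  end.

Definition valE (s : arrow) : S := (value (src s) (tgt s, lab s)).1.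
Definition valE' (s : arrow) : S := (value (src s) (tgt s, lab s)).2.
Definition valJ (k : elt) : S := valE' (larr k) * valE (larr k).

Lemma val_base h b : h \in hs -> value h b = (xi h, xi h).
Proof. by case: h => [//|l la d ra r] /= ->. Qed.

Lemma val_sandwich r s : fan_arrow s -> r <> s -> tgt r = tgt s ->
  let a := valE' r * valE s in let t := inv a in let g := sandwich r s in
  [/\ valE (larr g) = valE' s * valE s * (t * a),
      valE' (larr g) = t * a,
      valE (rarr g) = a &
      valE' (rarr g) = t * a * t * (valE' r * valE r)].
Proof.
move=> sV r_s rs; have /negbTE notin := sandwich_notin r sV.
have neq : ((src r, invA (lab r)) == (src s, invA (lab s))) = false.
  apply/eqP => -[e /(can_inj invAK) e']; apply: r_s.
  case: r s rs e e' {notin sV} => [[? ?] ?] [[? ?] ?].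
  by rewrite /tgt /src /lab /= => -> -> ->.
rewrite /valE /valE' /larr /rarr /src /tgt /lab /=.
rewrite -/(src r) -/(src s) -/(lab s) -/(lab r).
by rewrite -!/(tgt _) -!/(sandwich _ _) notin neq !invAK eqxx rs.
Qed.

(** The last clause has an exception for the fan arrows: their target is [c],
    and its identity is the adjoined one. *)
Lemma val_fan s : fan_arrow s ->
  [/\ valE s * valJ (src s) = valE s, valJ (src s) * valE' s = valE' s,
      valE' s * valE s = valJ (src s) &
      s \in map larr hs \/
      valJ (tgt s) * valE s = valE s /\ valE' s * valJ (tgt s) = valE' s].
Proof.
have key r q :
    [/\ valE q * valJ (src q) = valE q, valJ (src q) * valE' q = valE' q &
      valE' q * valE q = valJ (src q)] ->
    [/\ valE r * valJ (src r) = valE r, valJ (src r) * valE' r = valE' r &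
      valE' r * valE r = valJ (src r)] ->
    fan_arrow q -> r <> q -> tgt r = tgt q ->
    let g := sandwich r q in let l := larr g in let r' := rarr g in
    [/\ valE l * valJ g = valE l, valJ g * valE' l = valE' l,
      valE' l * valE l = valJ g,
      valJ (src q) * valE l = valE l & valE' l * valJ (src q) = valE' l] /\
    [/\ valE r' * valJ g = valE r', valJ g * valE' r' = valE' r',
      valE' r' * valE r' = valJ g,
      valJ (src r) * valE r' = valE r' & valE' r' * valJ (src r) = valE' r'].
  move=> [q1 q2 q3] [r1 r2 r3] qV r_q rq g l r'.
  have [e1 e2 e3 e4] := val_sandwich qV r_q rq.
  rewrite q3 in e1; rewrite r3 in e4.
  move: e1 e2 e3 e4; set a := valE' r * valE q; set t := inv a => e1 e2 e3 e4.
  have aq : a * valJ (src q) = a by rewrite /a -mulgA q1.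
  have ra : valJ (src r) * a = a by rewrite /a mulgA r2.
  have ata : a * (t * a) = a by rewrite mulgA invP.
  clearbody t; clearbody a.
  have tata : t * a * (t * a) = t * a by rewrite -mulgA ata.
  have qq : valJ (src q) * valJ (src q) = valJ (src q).
    by rewrite -{2}q3 mulgA q2 q3.
  have rr : valJ (src r) * valJ (src r) = valJ (src r).
    by rewrite -{2}r3 mulgA r2 r3.
  have gJ : valJ g = t * a.
    by rewrite /valJ e1 e2 mulgA -[t * a * _]mulgA aq tata.
  rewrite gJ {}/l {}/r' e1 e2 e3 e4; split; split.
  - by rewrite -mulgA tata.
  - by [].
  - by rewrite mulgA -[t * a * _]mulgA aq.
  - by rewrite mulgA qq.
  - by rewrite -mulgA aq.
  - by [].
  - by rewrite !mulgA -[t * a * t * a]mulgA tata.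
  - by rewrite -mulgA ra -mulgA tata.
  - by [].
  - by rewrite -mulgA rr.
elim=> {s} [h hh|r s rV [r1 r2 r3 _] sV [s1 s2 s3 _] r_s rs|
            r s rV [r1 r2 r3 _] sV [s1 s2 s3 _] r_s rs].
- have [e e'] : valE (larr h) = xi h /\ valE' (larr h) = xi h.
    by rewrite /valE /valE' val_base.
  by rewrite /valJ e e' !xi_idem; split=> //; left; exact: map_f.
- by have [[? ? ? ? ?] _] := key r s (And3 s1 s2 s3) (And3 r1 r2 r3) sV r_s rs;
    split=> //; right.
- by have [_ [? ? ? ? ?]] := key r s (And3 s1 s2 s3) (And3 r1 r2 r3) sV r_s rs;
    split=> //; right.
Qed.

Definition wuJ (k : elt) : with_unit S := if k == c then 1 else wu (valJ k).

Lemma val_interpretation :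
  interpretation fan_arrow wuJ (fun s => wu (valE s)) (fun s => wu (valE' s)).
Proof.
have Jsrc s : fan_arrow s -> wuJ (src s) = wu (valJ (src s)).
  by move=> /src_neq/eqP/negbTE sc; rewrite /wuJ sc.
have base s : s \in map larr hs -> wuJ (tgt s) = 1.
  by move=> /mapP[h /hsP[_ hc] ->]; rewrite /wuJ /tgt /= hc eqxx.
split=> [s sV|s sV|s sV|s sV|s sV|r s rV sV r_s rs];
  rewrite ?Jsrc //; try have [v1 v2 v3 v4] := val_fan sV.
- case: v4 => [/base->|[v _]]; first exact: mul1g.
  by rewrite /wuJ; case: eqP => _; rewrite ?mul1g // wuM v.
- by rewrite wuM v1.
- by rewrite wuM v2.
- case: v4 => [/base->|[_ v]]; first exact: mulg1.
  by rewrite /wuJ; case: eqP => _; rewrite ?mulg1 // wuM v.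
- by rewrite wuM v3.
- have [_ e2 e3 _] := val_sandwich sV r_s rs.
  by rewrite !wuM e2 e3 mulgA invP.
Qed.

Definition fan_elem (u v : seq arrow) : F11 := elem gen genE genE' c u v.
Definition val_elem (u v : seq arrow) : with_unit S :=
  elem wuJ (fun s => wu (valE s)) (fun s => wu (valE' s)) c u v.

(** Nonempty paths keep the element of [c] itself out; it would be sent to the
    adjoined identity. *)
Definition fan_semigroup : set F1 := [set a : F1 |
  exists u v, [/\ u <> [::], v <> [::], parallel fan_arrow c u v &
                 val a = fan_elem u v]].

Lemma theta_fan u v : parallel fan_arrow c u v ->
  theta (fan_elem u v) = zz (lpath c ++ u) (rpath c ++ v).
Proof. exact: theta_elem fan_high ci. Qed.

Lemma fan_elem_notunit u v : u <> [::] -> parallel fan_arrow c u v ->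
  fan_elem u v \in notunit.
Proof.
move=> u0 uv; rewrite inE; apply/eqP => /(congr1 theta).
rewrite theta_fan // -gen1 theta_gen; last exact: G_Sym.
by move=> /(congr1 fst) /=; case: (lpath c) => //=; case: u u0 {uv}.
Qed.

(** The value [s0] is used only outside [fan_semigroup]. *)
Definition fan_map (s0 : S) (a : F1) : S :=
  let z := theta (val a) in
  odflt s0 (val_elem (drop (size (lpath c)) z.1) (drop (size (rpath c)) z.2)).

Lemma fan_mapE s0 a u v : u <> [::] -> parallel fan_arrow c u v ->
  val a = fan_elem u v -> wu (fan_map s0 a) = val_elem u v.
Proof.
move=> u0 uv aE; rewrite /fan_map aE theta_fan //= !drop_size_cat //.
case: u u0 {uv aE} => [//|s u] _; rewrite /val_elem /elem /=.
case: (climb _ _ _ _) => [b|]; case: (descend _ _ _ _) => [d|] //.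
Qed.

Lemma gen_fan : interpretation fan_arrow gen genE genE'.
Proof. exact: gen_interpretation fan_closed fan_high. Qed.

Lemma gen_cc : gen c * gen c = gen c. Proof. exact: gen_idem ci. Qed.

Lemma fan_semigroupM a b : fan_semigroup a -> fan_semigroup b ->
  fan_semigroup (a * b).
Proof.
move=> [u [v [u0 v0 uv aE]]] [w [z [w0 z0 wz bE]]].
have [p e] := elemM fan_closed gen_fan gen_cc uv wz.
exists (u ++ (grid v w).1), (z ++ (grid v w).2); split=> //.
- by case: u u0 {uv aE p e}.
- by case: z z0 {wz bE p e}.
- by rewrite /fan_elem -e; rewrite -/(fan_elem u v) -/(fan_elem w z) -aE -bE.
Qed.

Lemma fan_semigroup_regular : regular fan_semigroup.
Proof.
move=> a [u [v [u0 v0 uv aE]]].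
have vu : parallel fan_arrow c v u by case: uv.
exists (exist _ (fan_elem v u) (fan_elem_notunit v0 vu) : F1).
  by exists v, u.
apply: val_inj; rewrite /= aE.
exact: (elem_regular fan_closed gen_fan gen_cc uv).
Qed.

Lemma fan_map_mul s0 a b : fan_semigroup a -> fan_semigroup b ->
  fan_map s0 (a * b) = fan_map s0 a * fan_map s0 b.
Proof.
move=> [u [v [u0 v0 uv aE]]] [w [z [w0 z0 wz bE]]].
have [p e] := elemM fan_closed gen_fan gen_cc uv wz.
have JJ : wuJ c * wuJ c = wuJ c by rewrite /wuJ eqxx mul1g.
have [_ f] := elemM fan_closed val_interpretation JJ uv wz.
suff [->] : wu (fan_map s0 (a * b)) = wu (fan_map s0 a * fan_map s0 b) by [].
rewrite -wuM (fan_mapE s0 u0 uv aE) (fan_mapE s0 w0 wz bE) /val_elem f.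
apply: fan_mapE p _; first by case: u u0 {uv aE e f}.
by rewrite /fan_elem -e; rewrite -/(fan_elem u v) -/(fan_elem w z) -aE -bE.
Qed.

Lemma fan_map_base s0 h : h \in hs ->
  exists2 a, fan_semigroup a & fan_map s0 a = xi h.
Proof.
move=> hh; have [hi hc] := hsP hh.
have hp : parallel fan_arrow c [:: larr h] [:: larr h].
  by split=> //; split=> //; exact: fan_base.
have ne : [:: larr h] <> [::] by [].
pose a : F1 :=
  exist _ (fan_elem [:: larr h] [:: larr h]) (fan_elem_notunit ne hp).
have aE : val a = fan_elem [:: larr h] [:: larr h] by [].
exists a; first by exists [:: larr h], [:: larr h].
suff [->] : wu (fan_map s0 a) = wu (xi h) by [].
rewrite (fan_mapE s0 ne hp aE) /val_elem /elem /= /wuJ.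
case: eqP => [e|_].
  have := height_object hi; rewrite e (height_object ci) => /eqP.
  by rewrite ltn_eqF.
by rewrite !wuM /valJ /valE /valE' !val_base //= !xi_idem.
Qed.
End Values.
End Fan.

Theorem corollary6p7 (S : semigroupType) (X : set S)
  (S_nonempty : [set: S] !=set0)
  (S_regular : regular [set: S])
  (X_finite : finite_set X)
  (X_idempotent : forall e : S, X e -> e * e = e)
  (X_wgen : weakly_generated X) :
  strongly_divides S F1.
Proof.
have [s0 _] := S_nonempty.
have /choice[inv invP] : forall a : S, exists b, a * b * a = a.
  by move=> a; have [b _ ab] := S_regular a I; exists b.
have /finite_seqP[xs XE] := X_finite.
pose e0 := s0 * inv s0.
have e0_idem : e0 * e0 = e0 by rewrite /e0 mulgA invP.
have [i [c [hs [ci Uhs hs_size hsP]]]] := fan (size xs).+1.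
(* The object left over by the list [xs] gets the default [e0]; it makes T
   nonempty when [X] is empty. *)
pose xi h := nth e0 xs (index h hs).
have xi_idem h : xi h * xi h = xi h.
  rewrite /xi; case: (ltnP (index h hs) (size xs)) => hx; last first.
    by rewrite nth_default.
  by apply: X_idempotent; rewrite XE; exact: mem_nth.
pose T := fan_semigroup c hs; pose phi := fan_map c hs inv xi s0.
have phiM a b : T a -> T b -> phi (a * b) = phi a * phi b.
  by apply: (fan_map_mul ci hsP invP xi_idem).
have base h : h \in hs -> exists2 a, T a & phi a = xi h.
  by move=> hh; exact: (fan_map_base ci hsP inv xi_idem s0 hh).
have T0 : T !=set0.
  have : nth c hs 0 \in hs by rewrite mem_nth // hs_size.
  by move=> /base[a Ta _]; exists a.
have TM : forall a b, T a -> T b -> T (a * b) by exact: (fan_semigroupM ci hsP).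
have Treg : regular T by exact: (fan_semigroup_regular ci hsP).
exists T, phi; split=> //.
apply: X_wgen.
- split; first by have [a Ta] := T0; exists (phi a), a.
  move=> _ _ [a Ta <-] [b Tb <-]; exists (a * b); last exact: phiM.
  exact: TM.
- move=> _ [a Ta <-]; have [b Tb ab] := Treg a Ta.
  exists (phi b); first by exists b.
  by rewrite -!phiM ?ab //; exact: TM.
- move=> x; rewrite XE /= => xx.
  have hx : nth c hs (index x xs) \in hs.
    by rewrite mem_nth // hs_size ltnS; exact: index_size.
  have [a Ta phia] := base _ hx; exists a => //.
  rewrite phia /xi index_uniq // ?nth_index // hs_size ltnS; exact: index_size.
Qed.
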